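(* Let $q$ be a prime power, let $m\ge1$ and $t$ be integers with $t+1\mid m$, let $H(x)\in\mathbb F_q[x]$ be a monic irreducible polynomial of degree $t+1$, and let $\alpha\in\mathbb F_{q^{t+1}}^*$ be a root of $H(x)$, so that $H(x)=\prod_{i=0}^t(x-\alpha^{q^i})$. Write $\alpha_i=\alpha^{q^{i-1}}$ for $1\le i\le t+1$, and let $L\subseteq\mathbb F_{q^m}$ be a set with $\alpha_1,\ldots,\alpha_{t+1}\in L$. Let $V(x)=\lambda_1x^\mu+\lambda_2$ with $\lambda_1,\lambda_2\in\mathbb F_{q^m}^*$ and $\mu>0$ an integer. Let $G(x)$ be the unique remainder of $V(x)H'(x)$ modulo $H(x)$, and assume that $G(\eta)\ne0$ for every $\eta\in L$. Let $N_\alpha=\operatorname{ord}(\alpha)$ be the multiplicative order of $\alpha$. Suppose that $$\lambda_1\operatorname{Tr}_{\mathbb F_{q^{t+1}}/\mathbb F_q}(\alpha^\mu)+(t+1)\lambda_2\ne0,$$ $$\frac{N_\alpha}{\gcd(N_\alpha,(q-1)^2)}\ \Big|\ \mu,$$ $$1+\frac{\lambda_2}{\lambda_1\alpha^{\mu q^t}}\in\mathbb F_q^*,$$ and $$\lambda_2\ne-\lambda_1\alpha^{\mu q^{i-1}},\qquad 1\le i\le t.$$ Then the $q$-ary Goppa code $\Gamma(L,G)$ has minimum distance $d(\Gamma(L,G))=t+1$.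
   Context: $H'(x)$ is the formal derivative of $H(x)$; the remainder $G(x)\in\mathbb F_{q^m}[x]$ is the polynomial of degree at most $t$ of the form $G(x)=U(x)H(x)+V(x)H'(x)$ with $U(x)\in\mathbb F_{q^m}[x]$. $\operatorname{Tr}_{\mathbb F_{q^{t+1}}/\mathbb F_q}(z)=\sum_{i=0}^t z^{q^i}$ is the field trace. Enumerate $L=\{\gamma_1,\ldots,\gamma_n\}$ with $n=|L|$. For a polynomial $G(x)\in\mathbb F_{q^m}[x]$ of degree at most $n$ with no zero in $L$, the $q$-ary Goppa code with support $L$ and Goppa polynomial $G$ is $$\Gamma(L,G)=\Bigl\{(c_1,\ldots,c_n)\in\mathbb F_q^n\ \Big|\ \sum_{i=1}^n\frac{c_i}{x-\gamma_i}\equiv0\pmod{G(x)}\Bigr\},$$ where $\frac1{x-\gamma_i}$ denotes the inverse of $x-\gamma_i$ modulo $G(x)$. The minimum distance $d(\mathcal C)$ of a linear code $\mathcal C$ is the minimum number of nonzero coordinates of a nonzero codeword. *)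

(* Defs.v *)
From mathcomp Require Import all_boot all_order all_algebra all_field.

Set Implicit Arguments.
Unset Strict Implicit.
Unset Printing Implicit Defensive.

Import GRing.Theory.
Local Open Scope ring_scope.

(* The residue modulo [g] of a Bezout coefficient of [p], rescaled because
   [egcdp] only yields a gcd up to a unit.  It is the inverse of [p] modulo [g]
   whenever [p] and [g] are coprime, see [inv_modpP] and [inv_modp_uniq]. *)
Definition inv_modp (K : fieldType) (g p : {poly K}) : {poly K} :=
  let e := egcdp p g in
  (((e.1 * p + e.2 * g)`_0)^-1 *: e.1) %% g.

Lemma inv_modpP (K : fieldType) (g p : {poly K}) :
  coprimep p g -> (inv_modp g p * p) %% g = 1 %% g.
Proof.
move=> cop; rewrite /inv_modp; set e := egcdp p g.
have := egcdpE p g; rewrite -/e => eqE.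
have sz1 : size (e.1 * p + e.2 * g) == 1%N by rewrite -(eqp_size eqE).
have /size_poly1P[c c0 Ec] := sz1.
rewrite mulrC modp_mul -scalerAr Ec coefC /= [p * _]mulrC.
have -> : e.1 * p = c%:P - e.2 * g by rewrite -Ec addrK.
rewrite scalerBr modpD -[c%:P]alg_polyC scalerA mulVf // scale1r.
by rewrite scalerAl -mulNr modp_mull addr0.
Qed.

Lemma inv_modp_uniq (K : fieldType) (g p u : {poly K}) :
  coprimep p g -> (u * p) %% g = 1 %% g -> u %% g = inv_modp g p.
Proof.
move=> cop up; have vp := inv_modpP cop.
have -> : inv_modp g p = inv_modp g p %% g by rewrite /inv_modp modp_id.
set v := inv_modp g p in vp *.
rewrite -[u in LHS]mulr1 -modp_mul -vp modp_mul.
by rewrite -[in RHS](mulr1 v) -[RHS]modp_mul -up modp_mul mulrCA.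
Qed.

Definition goppa_code (F : finFieldType) (E : fieldExtType F) (n : nat)
    (L : n.-tuple E) (G : {poly E}) : {set 'rV[F]_n} :=
  [set c : 'rV[F]_n |
     G %| \sum_(i < n) (c 0 i)%:A *: inv_modp G ('X - (tnth L i)%:P)].

Definition hamming_weight (F : finFieldType) (n : nat) (c : 'rV[F]_n) : nat :=
  #|[set i | c 0 i != 0]|.

(* A relation, so that the zero code is given no minimum distance. *)
Definition is_min_distance (F : finFieldType) (n : nat)
    (C : {set 'rV[F]_n}) (d : nat) : Prop :=
  (exists c, [/\ c \in C, c != 0 & hamming_weight c = d]) /\
  (forall c, c \in C -> c != 0 -> (d <= hamming_weight c)%N).

(* The trace to the subfield with [q] elements of an element [z] lying in the
   subfield with [q ^ t.+1] elements. *)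
Definition trace_q (E : fieldType) (q t : nat) (z : E) : E :=
  \sum_(i < t.+1) z ^+ (q ^ i).

(* Main.v *)
Require Import Defs.
From mathcomp Require Import all_boot all_order all_algebra all_field.

Set Implicit Arguments.
Unset Strict Implicit.
Unset Printing Implicit Defensive.

Import GRing.Theory.
Local Open Scope ring_scope.

(** Let [P] be the image of [H] in [E[x]], with roots [alpha ^+ (q ^ i)], [i <= t].
    The partial fraction expansion of [G / P] has the residue [V(r)] at each root
    [r] of [P], so the trace condition says that [G] has degree exactly [t], and
    the distance is at least [t + 1] because the residues of a codeword are the
    coefficients of a rational function whose numerator is a multiple of [G].
    Conversely [G / P] itself is, up to a scalar, the fraction of a codeword of
    weight [t + 1] as soon as the [V(r)] are proportional to elements of [F].
    The divisibility condition on [mu] makes the powers [r ^+ mu] a geometric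
    progression with ratio in [F], and the condition on
    [1 + lambda2 / (lambda1 * alpha ^+ (mu * q ^ t))] then says that [lambda2] is an
    [F]-multiple of [lambda1 * alpha ^+ (mu * q ^ t)]. *)

(** * Lagrange interpolation at finitely many nodes *)

Section Interpolation.

Variables (K : fieldType) (I : finType) (x : I -> K).
Implicit Types (S : {set I}) (i j : I).

Definition node_poly S : {poly K} := \prod_(i in S) ('X - (x i)%:P).
(** Up to scalars, the Lagrange basis at the nodes indexed by [S]. *)
Definition conode_poly S i : {poly K} := node_poly (S :\ i).

Lemma node_polyE S i :
  i \in S -> node_poly S = ('X - (x i)%:P) * conode_poly S i.
Proof. by move=> iS; rewrite /node_poly (big_setD1 i). Qed.

Lemma node_poly_monic S : node_poly S \is monic.
Proof. exact: monic_prod_XsubC. Qed.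

Lemma size_node_poly S : size (node_poly S) = #|S|.+1.
Proof. by rewrite /node_poly -big_enum /= size_prod_XsubC -cardE. Qed.

Lemma size_conode_poly S i : i \in S -> size (conode_poly S i) = #|S|.
Proof. by move=> iS; rewrite size_node_poly [in RHS](cardsD1 i) iS. Qed.

Lemma root_node_poly S i : i \in S -> root (node_poly S) (x i).
Proof. by move=> iS; rewrite (node_polyE iS) rootM root_XsubC eqxx. Qed.

Lemma conode_poly_eq0 S i j : j \in S -> j != i -> (conode_poly S i).[x j] = 0.
Proof. by move=> jS ji; apply/rootP/root_node_poly; rewrite in_setD1 ji. Qed.

Lemma conode_poly_neq0 S i :
  {in S &, injective x} -> i \in S -> (conode_poly S i).[x i] != 0.
Proof.
move=> x_inj iS; rewrite horner_prod; apply/prodf_neq0 => j.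
rewrite in_setD1 !hornerE subr_eq0 => /andP[ji jS].
by apply: contra ji => /eqP /x_inj ->.
Qed.

Lemma deriv_node_poly S i :
  i \in S -> (node_poly S)^`().[x i] = (conode_poly S i).[x i].
Proof.
move=> iS; rewrite (node_polyE iS) derivM derivXsubC mul1r.
by rewrite !hornerE subrr mul0r addr0.
Qed.

Lemma horner_sum_conode S (w : I -> K) i : i \in S ->
  (\sum_(j in S) w j *: conode_poly S j).[x i] = w i * (conode_poly S i).[x i].
Proof.
move=> iS; rewrite horner_sum (big_setD1 i) //= hornerZ big1 ?addr0 // => j.
rewrite in_setD1 => /andP[ji jS].
by rewrite hornerZ conode_poly_eq0 ?mulr0 // eq_sym.
Qed.

Lemma size_sum_conode S (w : I -> K) :
  (size (\sum_(j in S) w j *: conode_poly S j)%R <= #|S|)%N.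
Proof.
apply/(leq_trans (size_sum _ _ _))/bigmax_leqP => j jS.
by rewrite (leq_trans (size_scale_leq _ _)) // size_conode_poly.
Qed.

(** Each [conode_poly] is monic of degree [#|S|.-1]. This coefficient will give the degree of
    [G]. *)
Lemma coef_sum_conode S (w : I -> K) :
  (\sum_(j in S) w j *: conode_poly S j)`_#|S|.-1 = \sum_(j in S) w j.
Proof.
rewrite coef_sum; apply: eq_bigr => j jS.
rewrite coefZ -(size_conode_poly jS) -lead_coefE.
by rewrite (monicP (node_poly_monic _)) mulr1.
Qed.

(* The partial fraction expansion of [V * P' / P], with [P] squarefree. *)
Lemma modp_deriv_node S (V : {poly K}) : {in S &, injective x} ->
  (V * (node_poly S)^`()) %% node_poly S =
  \sum_(i in S) V.[x i] *: conode_poly S i.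
Proof.
move=> x_inj; set P := node_poly S; set G := (_ * _) %% _; set Q := \sum_(i in _) _.
apply/eqP; rewrite -subr_eq0; apply/eqP.
(* Both sides have degree below [#|S|] and agree at the [#|S|] nodes. *)
apply: (@roots_geq_poly_eq0 _ _ [seq x i | i in S]).
- apply/allP => _ /imageP[i iS ->]; rewrite rootE !hornerE /Q horner_sum_conode //.
  have PE := divp_eq (V * P^`()) P; have /rootP Pi0 := root_node_poly iS.
  have <- : (V * P^`()).[x i] = G.[x i].
    by rewrite PE hornerD hornerM Pi0 mulr0 add0r.
  by rewrite hornerM deriv_node_poly // subrr.
- by rewrite map_inj_in_uniq ?enum_uniq // => i j; rewrite !mem_enum; apply: x_inj.
rewrite size_map -cardE (leq_trans (size_polyD _ _)) // size_polyN geq_max.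
rewrite size_sum_conode andbT -ltnS -(size_node_poly S).
by rewrite ltn_modp monic_neq0 // node_poly_monic.
Qed.

End Interpolation.

(** * Lower bound on the weight of a codeword *)

Section GoppaBound.

Variables (F : finFieldType) (E : fieldExtType F) (n : nat).
Variables (L : n.-tuple E) (G : {poly E}).
Hypothesis G_neq0 : forall eta, eta \in L -> G.[eta] != 0.
Implicit Types (c : 'rV[F]_n) (S : {set 'I_n}).

Lemma coprime_node_goppa S : coprimep G (node_poly (tnth L) S).
Proof.
apply: (big_ind (coprimep G)) => [|p r pP rP|i _].
- exact: coprimep1.
- by rewrite coprimepMr pP.
by rewrite coprimep_XsubC rootE G_neq0 // mem_tnth.
Qed.

(* Clearing denominators in the defining congruence. *)
Lemma mem_goppa_code c S : (forall i, c 0 i != 0 -> i \in S) ->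
  (c \in goppa_code L G) =
  (G %| \sum_(i in S) (c 0 i)%:A *: conode_poly (tnth L) S i).
Proof.
move=> cS; rewrite inE -(Gauss_dvdpr _ (coprime_node_goppa S)).
rewrite mulr_sumr (bigID [in S]) /= [X in _ + X]big1 ?addr0; last first.
  move=> i iS; have /eqP -> : c 0 i == 0 by apply: contraNT iS => /cS.
  by rewrite scale0r scale0r mulr0.
rewrite /dvdp !(big_morph _ (modpD G) (mod0p G)).
congr (_ == 0); apply: eq_bigr => i iS; rewrite -scalerAr !modpZl; congr (_ *: _).
have copr : coprimep ('X - (tnth L i)%:P) G.
  by rewrite coprimep_sym coprimep_XsubC rootE G_neq0 // mem_tnth.
rewrite (node_polyE _ iS) mulrAC mulrC [_ * inv_modp _ _]mulrC.
by rewrite -modp_mul inv_modpP // modp_mul mulr1.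
Qed.

(** Over the support of [c], the cleared numerator has size at most the weight; it is a multiple of
    [G], nonzero because its value at a support node is a nonzero coordinate times a nonzero conode
    value. *)
Lemma goppa_bound c :
  injective (tnth L) -> c \in goppa_code L G -> c != 0 ->
  (size G <= hamming_weight c)%N.
Proof.
move=> L_inj; rewrite /hamming_weight; set S := [set i | _].
have cS i : c 0 i != 0 -> i \in S by rewrite inE.
rewrite (mem_goppa_code cS) => Gdvd c_neq0.
have [i ci] : exists i, c 0 i != 0.
  apply/existsP; apply: contraNT c_neq0; rewrite negb_exists => /forallP c0.
  by apply/eqP/rowP => i; have := c0 i; rewrite mxE negbK => /eqP.
have iS := cS _ ci.
apply: leq_trans (size_sum_conode (tnth L) S (fun i => (c 0 i)%:A)).
apply: dvdp_leq Gdvd; apply/eqP => /(congr1 (horner^~ (tnth L i))) /eqP.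
rewrite /= horner_sum_conode // horner0 mulf_eq0 (negPf (conode_poly_neq0 _ iS)).
  by rewrite scaler_eq0 oner_eq0 (negPf ci).
by move=> j k _ _; apply: L_inj.
Qed.

End GoppaBound.

(** * Frobenius powers and the conjugates of a root *)

Section Frobenius.

Variables (F : finFieldType) (E : fieldExtType F).
Implicit Types (x y : E) (p : {poly F}).

Lemma mem_base_Frobenius x : x ^+ #|F| = x -> exists a : F, x = a%:A.
Proof.
move=> xq; have /vlineP[a ->] : x \in 1%VS; last by exists a.
by rewrite (Fermat's_little_theorem 1%AS) dimv1 expn1 xq.
Qed.

Lemma pchar_pnat_card : [pchar E].-nat #|F|.
Proof.
have [p p_pr pF] := finPcharP F.
by rewrite (card_pprimeChar pF) pnatX pnatE // pchar_lalg pF.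
Qed.

Lemma exprD_card k x y : (x + y) ^+ (#|F| ^ k) = x ^+ (#|F| ^ k) + y ^+ (#|F| ^ k).
Proof. by rewrite exprDn_pchar // pnatX pchar_pnat_card. Qed.

Lemma expr_card_inj k : injective (fun x : E => x ^+ (#|F| ^ k)).
Proof.
move=> x y /= eq_xy; apply/eqP; rewrite -subr_eq0.
have : (x - y) ^+ (#|F| ^ k) == 0.
  by rewrite -(inj_eq (addIr (y ^+ (#|F| ^ k)))) -exprD_card subrK add0r eq_xy.
by rewrite expf_eq0 => /andP[].
Qed.

Lemma expf_card_iter k (a : F) : a ^+ (#|F| ^ k) = a.
Proof. by elim: k => [|k IHk]; rewrite ?expr1 // expnS exprM expf_card. Qed.

Lemma horner_Frobenius k p x :
  (map_poly (in_alg E) p).[x ^+ (#|F| ^ k)] =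
  (map_poly (in_alg E) p).[x] ^+ (#|F| ^ k).
Proof.
elim/poly_ind: p => [|p a IHp].
  by rewrite rmorph0 !horner0 expr0n eqn0Ngt expn_gt0 ltnW ?finNzRing_gt1.
rewrite rmorphD rmorphM /= map_polyX map_polyC /= !hornerE IHp exprD_card exprMn.
by rewrite -[(a%:A) ^+ _](rmorphXn (in_alg E)) expf_card_iter.
Qed.

(** Otherwise [H] and [p] would be coprime over [F], hence over [E], and could not share the root
    [x]. *)
Lemma irreducible_dvdp_root (H p : {poly F}) x :
  irreducible_poly H -> root (map_poly (in_alg E) H) x ->
  root (map_poly (in_alg E) p) x -> H %| p.
Proof.
move=> H_irr Hx px; rewrite -[_ %| _]negbK -irreducible_poly_coprime //.
rewrite -(coprimep_map (in_alg E)); apply/negP => /coprimep_root /(_ Hx).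
by rewrite -rootE px.
Qed.

(* If [alpha] has degree [d] and is fixed by the [k]-th power of Frobenius, then
   the [q ^ d] elements of [F(alpha)] are roots of ['X^(q ^ k) - 'X]. *)
Lemma Frobenius_fixed_degree (H : {poly F}) x d k :
  irreducible_poly H -> root (map_poly (in_alg E) H) x -> size H = d.+1 ->
  (0 < k)%N -> x ^+ (#|F| ^ k) = x -> (d <= k)%N.
Proof.
move=> H_irr Hx szH k_gt0 xk; have q_gt1 := finNzRing_gt1 F.
have qk_gt1 : (1 < #|F| ^ k)%N by rewrite -(exp1n k) ltn_exp2r.
pose ev (v : 'rV[F]_d) : E := (map_poly (in_alg E) (rVpoly v)).[x].
(* A nonzero difference has degree below [d], so [H] cannot divide it. *)
have ev_inj : injective ev.
  move=> u v uv; apply: (can_inj rVpolyK); apply/eqP; rewrite -subr_eq0.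
  have : H %| rVpoly u - rVpoly v.
    apply: (irreducible_dvdp_root H_irr Hx).
    by rewrite rootE rmorphB !hornerE /= -/(ev u) uv subrr.
  apply: contraTT => /gtNdvdp -> //; rewrite szH ltnS -linearB /=.
  exact: size_poly.
have sz : size ('X^(#|F| ^ k) - 'X : {poly E}) = (#|F| ^ k).+1.
  by rewrite size_polyDl size_polyXn // size_polyN size_polyX ltnS.
have := @max_poly_roots E ('X^(#|F| ^ k) - 'X) [seq ev v | v : 'rV[F]_d].
rewrite -size_poly_eq0 sz map_inj_uniq ?enum_uniq // size_map -cardE card_mx mul1n.
rewrite ltnS leq_exp2l //; apply=> //.
apply/allP => _ /imageP[v _ ->].
by rewrite rootE !hornerE -horner_Frobenius xk subrr.
Qed.

(** If two exponents [i < j] gave the same conjugate, cancelling [q ^ i] would make [x] fixed by the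
    power [j - i < d] of Frobenius. *)
Lemma Frobenius_orbit_inj (H : {poly F}) x d :
  irreducible_poly H -> root (map_poly (in_alg E) H) x -> size H = d.+1 ->
  injective (fun i : 'I_d => x ^+ (#|F| ^ i)).
Proof.
move=> H_irr Hx szH.
have main (i j : 'I_d) : (i < j)%N -> x ^+ (#|F| ^ i) != x ^+ (#|F| ^ j).
  move=> ij; apply/eqP; rewrite -[in RHS](subnK (ltnW ij)) expnD exprM.
  move=> /(@expr_card_inj i) /esym /(Frobenius_fixed_degree H_irr Hx szH).
  by rewrite subn_gt0 => /(_ ij); rewrite leqNgt (leq_ltn_trans (leq_subr _ _)).
move=> i j eq_ij; apply/eqP; case: (ltngtP i j) => [ltij|ltij|/val_inj-> //].
- by have := main i j ltij; rewrite eq_ij eqxx.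
- by have := main j i ltij; rewrite eq_ij eqxx.
Qed.

End Frobenius.

(* As [beta ^ (q - 1)] is itself fixed by Frobenius, the conjugates of [beta]
   form a geometric progression with ratio in [F]. *)
Lemma Frobenius_geometric (F : finFieldType) (E : fieldExtType F) (beta : E) :
  beta ^+ ((#|F| - 1) ^ 2) = 1 ->
  exists2 z : F, z != 0 & forall k, beta ^+ (#|F| ^ k) = z ^+ k *: beta.
Proof.
move=> beta1; have q_gt0 : (0 < #|F|)%N := ltnW (finNzRing_gt1 F).
have zq1 : (beta ^+ (#|F| - 1)) ^+ (#|F| - 1) = 1 by rewrite -exprM mulnn.
have [|z zE] := @mem_base_Frobenius F E (beta ^+ (#|F| - 1)).
  by rewrite -[in X in _ ^+ X](subnK q_gt0) exprD zq1 mul1r.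
have z_neq0 : z != 0.
  apply/eqP => z0; move/eqP: beta1; rewrite -mulnn exprM zE z0 scale0r expr0n.
  by rewrite subn_eq0 leqNgt finNzRing_gt1 eq_sym oner_eq0.
have betaq : beta ^+ #|F| = z *: beta.
  by rewrite -mulr_algl -zE -[in LHS](subnK q_gt0) exprD.
exists z => //; elim=> [|k IHk]; first by rewrite !expr0 scale1r.
rewrite expnSr exprM IHk -mulr_algl exprMn betaq.
by rewrite -[_%:A ^+ _](rmorphXn (in_alg E)) expf_card mulr_algl scalerA exprSr.
Qed.

Theorem mainTheorem4
    (q m t n mu N : nat)
    (F : finFieldType) (hq : #|F| = q)
    (E : fieldExtType F) (hm : (1 <= m)%N) (hE : \dim {:E} = m)
    (htm : (t.+1 %| m)%N)
    (K : {subfield E}) (hK : \dim K = t.+1)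
    (H : {poly F}) (hHmonic : H \is monic) (hHirr : irreducible_poly H)
    (hHdeg : size H = t.+2)
    (alpha : E) (halphaK : alpha \in K) (halpha0 : alpha != 0)
    (halphaH : root (map_poly (in_alg E) H) alpha)
    (L : n.-tuple E) (hL : uniq L)
    (hLalpha : forall i : nat, (1 <= i <= t.+1)%N ->
       alpha ^+ (q ^ i.-1) \in L)
    (lambda1 lambda2 : E) (hlambda1 : lambda1 != 0) (hlambda2 : lambda2 != 0)
    (hmu : (0 < mu)%N)
    (V : {poly E}) (hV : V = lambda1 *: 'X^mu + lambda2%:P)
    (G : {poly E})
    (hG : G = (V * (map_poly (in_alg E) H)^`()) %% map_poly (in_alg E) H)
    (hGL : forall eta : E, eta \in L -> G.[eta] != 0)
    (hN : N.-primitive_root alpha)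
    (hTr : lambda1 * trace_q q t (alpha ^+ mu) + t.+1%:R * lambda2 != 0)
    (hNmu : (N %/ gcdn N ((q - 1) ^ 2) %| mu)%N)
    (hFq : exists2 a : F, a != 0 &
       1 + lambda2 / (lambda1 * alpha ^+ (mu * q ^ t)) = a%:A)
    (hne : forall i : nat, (1 <= i <= t)%N ->
       lambda2 != - lambda1 * alpha ^+ (mu * q ^ i.-1)) :
  is_min_distance (goppa_code L G) t.+1.
Proof.
subst q; set q := #|F| in hLalpha hTr hNmu hFq.
have L_inj : injective (tnth L) by apply/tuple_uniqP.
have orb_inj := Frobenius_orbit_inj hHirr halphaH hHdeg.
(* [f i] is the position in [L] of the conjugate [alpha ^+ (q ^ i)]. *)
have /fin_all_exists[f fE] (i : 'I_t.+1) : exists j, tnth L j = alpha ^+ (q ^ i).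
  by have /tnthP[j ->] := hLalpha i.+1 (ltn_ord i); exists j.
have f_inj : injective f.
  by move=> i j fij; apply: orb_inj; rewrite /= -/q -!fE fij.
pose S := [set f i | i in 'I_t.+1].
have cardS : #|S| = t.+1 by rewrite card_imset // card_ord.
have fS i : f i \in S by apply: imset_f.
have nodeE : map_poly (in_alg E) H = node_poly (tnth L) S.
  rewrite (@all_roots_prod_XsubC _ (map_poly (in_alg E) H) [seq alpha ^+ (q ^ i) | i : 'I_t.+1]).
  - rewrite lead_coef_map (monicP hHmonic) rmorph1 scale1r big_image /=.
    rewrite /node_poly big_imset /=; last by move=> i j _ _ /f_inj.
    by apply: eq_bigr => i _; rewrite fE.
  - by rewrite size_map_poly hHdeg size_map -cardE card_ord.
  - apply/allP => _ /imageP[i _ ->]; rewrite rootE horner_Frobenius (rootP halphaH).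
    by rewrite expr0n eqn0Ngt expn_gt0 ltnW ?finNzRing_gt1.
  by rewrite uniq_rootsE map_inj_uniq ?enum_uniq.
have GE : G = \sum_(i in S) V.[tnth L i] *: conode_poly (tnth L) S i.
  by rewrite hG nodeE modp_deriv_node // => i j _ _ /L_inj.
have VE i : V.[tnth L (f i)] = lambda1 * (alpha ^+ mu) ^+ (q ^ i) + lambda2.
  by rewrite hV fE !hornerE exprAC.
(* The coefficient of degree [t] in [G] is the sum of [V] over the roots, which is the left side of
   [hTr]. *)
have szG : (t < size G)%N.
  rewrite ltnNge; apply: contra hTr => /leq_sizeP/(_ t (leqnn t)).
  have := coef_sum_conode (tnth L) S (fun i => V.[tnth L i]).
  rewrite -GE cardS /= => ->; rewrite big_imset /=; last by move=> i j _ _ /f_inj.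
  under eq_bigr do rewrite VE.
  by rewrite big_split /= -mulr_sumr sumr_const card_ord mulr_natl => ->.
have V_neq0 i : V.[tnth L (f i)] != 0.
  have := hGL _ (mem_tnth (f i) L); rewrite GE horner_sum_conode //.
  by apply: contraNneq => ->; rewrite mul0r.
(* [N] is the product of [N %/ gcdn N ((q - 1) ^ 2)], which divides [mu], and of the gcd, which
   divides [(q - 1) ^ 2]. *)
have beta1 : (alpha ^+ mu) ^+ ((q - 1) ^ 2) = 1.
  apply/eqP; rewrite -exprM -(prim_order_dvd hN).
  by rewrite -[X in (X %| _)%N](divnK (dvdn_gcdl N ((q - 1) ^ 2))) dvdn_mul ?dvdn_gcdr.
have [z z_neq0 zE] := Frobenius_geometric beta1.
(* [kappa] is [lambda1 * alpha ^+ (mu * q ^ t)], the common factor of the values of [V] at the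
   roots. *)
case: hFq => a _; rewrite exprM zE; set kappa := lambda1 * _ => aE.
have kappa_neq0 : kappa != 0.
  by rewrite mulf_neq0 // scaler_eq0 negb_or !expf_neq0.
have lambda2E : lambda2 = kappa * (a - 1)%:A.
  by rewrite scalerBl scale1r -aE addrAC subrr add0r mulrC divfK.
(* The value of [V] at the [i]-th conjugate, divided by [kappa]: the ratio of powers of [z] comes
   from the [lambda1] term, [a - 1] from [lambda2]. *)
pose w (i : 'I_t.+1) := z ^+ i / z ^+ t + (a - 1).
have VwE i : V.[tnth L (f i)] = kappa * (w i)%:A.
  rewrite VE zE [in LHS]lambda2E /w [in RHS]scalerDl mulrDr; congr (_ + _).
  by rewrite mulr_algr /kappa -!scalerAr scalerA divfK // expf_neq0.
(* As [f] is injective, each sum has at most one term; off [S] it is empty, so the coordinate is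
   0. *)
pose c : 'rV[F]_n := \row_j \sum_(i | f i == j) w i.
have cE i : c 0 (f i) = w i.
  by rewrite mxE (eq_bigl (pred1 i)) ?big_pred1_eq // => j; rewrite (inj_eq f_inj).
have cS j : c 0 j != 0 -> j \in S.
  apply: contraNT => jS; rewrite mxE big_pred0 // => i.
  by apply: contraNF jS => /eqP <-.
have w_neq0 i : w i != 0.
  by apply: contraNneq (V_neq0 i) => wi; rewrite VwE wi scale0r mulr0.
have wt_c : hamming_weight c = t.+1.
  rewrite /hamming_weight -cardS; congr #|pred_of_set _|; apply/setP => j.
  by rewrite inE; apply/idP/idP => [/cS //|/imsetP[i _ ->]]; rewrite cE.
split=> [|c' c'C c'0]; last by apply: leq_trans szG _; apply: goppa_bound c'C c'0.
exists c; split=> //; last by apply: contraNneq (w_neq0 ord0) => c0; rewrite -cE c0 mxE.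
rewrite (mem_goppa_code hGL cS).
suff -> : \sum_(i in S) (c 0 i)%:A *: conode_poly (tnth L) S i = kappa^-1 *: G.
  by rewrite dvdpZr ?invr_eq0.
rewrite GE scaler_sumr; apply: eq_bigr => _ /imsetP[i _ ->].
by rewrite cE VwE scalerA mulKf.
Qed.
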